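(* Let $a\in\mathbb{R}$, $T>0$ and let $\mathcal{G}_{\mathrm{adv}}$ and $\mu$ be as in the context. Let $M>0$. There exists a constant $C>0$, depending only on $M$ and $\mu$ (in particular independent of $m$ and $p$), such that for any $m,p\in\mathbb{N}$, any choice of sensor points $x_1,\dots,x_m\in\mathbb{T}$, any measurable branch map $\boldsymbol\beta:\mathbb{R}^m\to\mathbb{R}^p$ and any trunk functions $\tau_1,\dots,\tau_p\in L^2(\mathbb{T})$, the DeepONet $\mathcal{N}^{\mathrm{DON}}(\bar u)(y)=\sum_{k=1}^p\beta_k(\bar u(x_1),\dots,\bar u(x_m))\tau_k(y)$ satisfying $\sup_{\bar u\in\operatorname{supp}\mu}\|\mathcal{N}^{\mathrm{DON}}(\bar u)\|_{L^\infty}\le M$ obeys \[ \mathbb{E}_{\bar u\sim\mu}\big[\|\mathcal{G}_{\mathrm{adv}}(\bar u)-\mathcal{N}^{\mathrm{DON}}(\bar u)\|_{L^1(\mathbb{T})}\big]\ \ge\ \frac{C}{\min(m,p)}. \]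
   Context: $\mathbb{T}=\mathbb{R}/2\pi\mathbb{Z}$ (identified with $[0,2\pi)$), with Lebesgue measure. Fix constants $0<\underline h\le\overline h$ and $0<\underline w\le\overline w<2\pi$. The input measure $\mu$ is the law of the random function $\bar u(x)=h\,1_{[-w/2,w/2]}(x-\xi)$ (understood $2\pi$-periodically on $\mathbb{T}$), where $h\sim\mathrm{Unif}[\underline h,\overline h]$, $w\sim\mathrm{Unif}[\underline w,\overline w]$, $\xi\sim\mathrm{Unif}[0,2\pi]$ are independent. For fixed speed $a\in\mathbb{R}$ and time $T>0$, $\mathcal{G}_{\mathrm{adv}}$ is the solution operator at time $T$ of the linear advection equation $\partial_tu+a\partial_xu=0$ on $\mathbb{T}$, i.e. $\mathcal{G}_{\mathrm{adv}}(\bar u)(x)=\bar u(x-aT)$. *)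

(* Defs.v *)
From HB Require Import structures.
From mathcomp Require Import all_boot all_order all_algebra.
From mathcomp Require Import all_classical all_reals all_analysis.

Set Implicit Arguments.
Unset Strict Implicit.
Unset Printing Implicit Defensive.

Import Order.TTheory GRing.Theory Num.Theory.
Import numFieldNormedType.Exports.

Local Open Scope classical_set_scope.
Local Open Scope ring_scope.

Section Defs.
Variable R : realType.

(* The torus T = R/2piZ, identified with the fundamental domain [0, 2pi). *)
Definition torus : set R := `[0, 2 * pi[.

Definition bump_set (w xi : R) : set R :=
  [set x | exists k : int, `|x - xi - k%:~R * (2 * pi)| <= w / 2].

Definition ubar (h w xi : R) : R -> R := fun x => h * \1_(bump_set w xi) x.

(* Solution operator of u_t + a u_x = 0 at time T. *)
Definition Gadv (a T : R) (u : R -> R) : R -> R := fun x => u (x - a * T).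

(* Uniform law on [lo, hi] (lo <= hi; a Dirac mass if lo = hi), as the
   image of the uniform probability on [0,1] under t |-> lo + (hi - lo) t. *)
Definition unif (lo hi : R) : set R -> \bar R :=
  pushforward (uniform_prob (@ltr01 R)) (fun t => lo + (hi - lo) * t).

(* Expectation of F(ubar) for ubar ~ mu, with h ~ Unif[hl,hh],
   w ~ Unif[wl,wh], xi ~ Unif[0,2pi] independent (iterated integrals
   against the three independent marginal laws). *)
Definition mu_expect (hl hh wl wh : R) (F : (R -> R) -> \bar R) : \bar R :=
  (\int[unif hl hh]_h \int[unif wl wh]_w \int[unif 0 (2 * pi)]_xi
     F (ubar h w xi))%E.

Definition supp_mu (hl hh wl wh : R) : set (R -> R) :=
  [set u | exists h w xi, [/\ h \in `[hl, hh], w \in `[wl, wh],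
                              xi \in `[0, 2 * pi] & u = ubar h w xi]].

Definition L1_dist (f g : R -> R) : \bar R :=
  (\int[lebesgue_measure]_(y in torus) (`|f y - g y|)%:E)%E.

Definition Linf_le (M : R) (f : R -> R) : Prop :=
  {ae lebesgue_measure, forall y, torus y -> `|f y| <= M}.

Definition in_L2 (f : R -> R) : Prop :=
  measurable_fun torus f /\
  (\int[lebesgue_measure]_(y in torus) (f y ^+ 2)%:E < +oo)%E.

Definition borel_measurable (m p : nat) (f : 'rV[R]_m -> 'rV[R]_p) : Prop :=
  forall B : set 'rV[R]_p, open B -> <<s open >> (f @^-1` B).

Definition deeponet (m p : nat) (beta : 'rV[R]_m -> 'rV[R]_p)
  (tau : 'I_p -> R -> R) (x : 'I_m -> R) (u : R -> R) : R -> R :=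
  fun y => \sum_(k < p) beta (\row_(j < m) u (x j)) 0 k * tau k y.

End Defs.

(* Main.v *)
(** Fix the height [h] and the width [w], and let the center [xi] run through a
    window shorter than both [w] and [2 pi - w].  On a suitable arc of the torus
    the advected bump is then the step function [h * 1[y <= z]], whose jump [z]
    moves with [xi].  Sample the window at [2 q + 1] equidistant centers, where
    [q = min m p], and average over the cells between consecutive jumps: the
    differences of consecutive bumps become [h d] times the identity matrix
    ([d] the spacing), those of the network outputs a product [c *m t].
    Few rows of [c *m t] can be closer than [h d] to the identity in l1 norm:
    at most [p], since [c] has rank at most [p], and at most [m], since such a
    row of [c] is nonzero and each sensor value changes at most once along the
    window.  So [q] of the [2 q] rows contribute at least [h d] each, and
    averaging over the position of the grid gives an error of order [1 / q]. *)
Require Import Defs.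
From HB Require Import structures.
From mathcomp Require Import all_boot all_order all_algebra.
From mathcomp Require Import all_classical all_reals all_analysis.
From mathcomp Require Import measurable_realfun zify ring lra.
Import Order.TTheory GRing.Theory Num.Theory.
Import numFieldNormedType.Exports.
Local Open Scope ring_scope.

Set Implicit Arguments.
Unset Strict Implicit.
Unset Printing Implicit Defensive.

(** * Linear algebra: l1 distance from a low-rank matrix to a scalar matrix *)

Section ApproxIdentity.
Variables (R : realFieldType) (n p : nat) (c : 'M[R]_(n, p)) (t : 'M[R]_(p, n)).
Variable d : R.
Hypothesis d_gt0 : 0 < d.

Let E := d%:M - c *m t.
Let close := [set j | \sum_i `|E j i| < d].

(** The rows of [c] indexed by [S] outnumber its columns, so they are linearly dependent; [u] is
    such a dependence extended by zero. *)
Lemma left_kernel_supported (S : {set 'I_n}) : (p < #|S|)%N ->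
  exists u : 'rV[R]_n,
    [/\ u != 0, u *m c = 0 & forall j, j \notin S -> u 0 j = 0].
Proof.
move=> pS; pose ev := enum_val : 'I_#|S| -> 'I_n.
have : kermx (rowsub ev c) != 0.
  rewrite kermx_eq0 /row_free; apply/eqP => rkS.
  by have := rank_leq_col (rowsub ev c); rewrite rkS leqNgt pS.
case/rowV0Pn => v /sub_kermxP vc0 v_neq0.
exists (v *m rowsub ev 1%:M); split.
- apply: contra_neq v_neq0 => uE; apply/rowP => i.
  have /rowP/(_ (ev i)) := uE; rewrite !mxE => <-.
  rewrite (bigD1 i)//= !mxE eqxx mulr1 big1 ?addr0// => k ki.
  rewrite !mxE; case: eqP => [/enum_val_inj ki'|_]; last by rewrite mulr0.
  by rewrite ki' eqxx in ki.
- by rewrite -mulmxA mul_rowsub_mx mul1mx.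
- move=> j jS; rewrite mxE big1// => k _; rewrite !mxE.
  case: eqP => [ej|_]; last by rewrite mulr0.
  by rewrite -ej enum_valP in jS.
Qed.

(* A left null vector [u] of [c] supported on the close rows satisfies
   [d *: u = u *m E], which contradicts the row sums of [E] in l1 norm. *)
Lemma card_close_rows : (#|close| <= p)%N.
Proof.
rewrite leqNgt; apply/negP => /left_kernel_supported[u [u0 uc0 uS]].
have uE : u *m E = d *: u.
  by rewrite mulmxBr mulmxA uc0 mul0mx subr0 mul_mx_scalar.
have [j uj0] : exists j, u 0 j != 0.
  apply/existsP; apply: contraR u0; rewrite negb_exists => /forallP h.
  by apply/eqP/rowP => j; rewrite mxE; apply/eqP; rewrite -[_ == _]negbK.
have : \sum_i `|u 0 i| * d < \sum_i `|u 0 i| * d.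
  apply: (@le_lt_trans _ _ (\sum_j `|u 0 j| * \sum_i `|E j i|)).
    have uEi i : `|u 0 i| * d = `|(u *m E) 0 i|.
      by rewrite uE mxE normrM (gtr0_norm d_gt0) mulrC.
    under eq_bigr do rewrite uEi.
    apply: (@le_trans _ _ (\sum_i \sum_j `|u 0 j| * `|E j i|)).
      apply: ler_sum => i _; rewrite mxE.
      apply: le_trans (ler_norm_sum _ _ _) _.
      by apply: ler_sum => k _; rewrite normrM.
    by rewrite exchange_big; apply: ler_sum => k _; rewrite mulr_sumr.
  rewrite [ltLHS](bigD1 j)//= [ltRHS](bigD1 j)//=.
  have lt_close k : k \in close -> \sum_i `|E k i| < d by rewrite inE.
  apply: ltr_leD.
    rewrite ltr_pM2l ?normr_gt0//; apply: lt_close.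
    by apply: contraNT uj0 => /uS ->.
  apply: ler_sum => k _; have [/lt_close/ltW|/uS ->] := boolP (k \in close).
    by apply: ler_wpM2l.
  by rewrite normr0 !mul0r.
by rewrite ltxx.
Qed.

(** If row [j] of [c] vanishes, the diagonal entry [E j j] equals [d], and it alone excludes [j]
    from [close]. *)
Lemma close_row_neq0 j : j \in close -> row j c != 0.
Proof.
rewrite inE; apply: contraTneq => rj0; rewrite -leNgt (bigD1 j)//=.
have -> : E j j = d.
  rewrite !mxE eqxx mulr1n big1 ?subr0// => k _.
  by have /rowP/(_ k) := rj0; rewrite !mxE => ->; rewrite mul0r.
by rewrite (gtr0_norm d_gt0) lerDl sumr_ge0.
Qed.

(** In the application [ch j i] says that sensor [i] changes between samples [j] and [j.+1].
    Choosing such an [i] for each close row is injective, which bounds their number by [m]; the rank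
    bounds it by [p]. Every other row contributes at least [d]. *)
Lemma l1_dist_scalar_ge (m : nat) (ch : 'I_n -> 'I_m -> bool) :
    (forall j, row j c != 0 -> exists i, ch j i) ->
    (forall i j j', ch j i -> ch j' i -> j = j') ->
  (n - minn m p)%:R * d <= \sum_j \sum_i `|E j i|.
Proof.
move=> chE ch_inj.
have close_m : (#|close| <= m)%N.
  have chP j : {i | j \in close -> ch j i} + (j \notin close).
    have [jc|] := boolP (j \in close); last by right.
    by left; have /sigW[i ji] := chE _ (close_row_neq0 jc); exists i.
  (* The option type makes [f] total: rows that are not close may have no witness. *)
  pose f j := if chP j is inl i then Some (sval i) else None.
  have f_inj : {in close &, injective f}.
    move=> j j' jc j'c; rewrite /f.
    case: (chP j) => [[i hi]|]; last by rewrite jc.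
    case: (chP j') => [[i' hi']|]; last by rewrite j'c.
    by move=> /= [ii']; apply: (ch_inj i); [exact: hi|rewrite ii'; exact: hi'].
  rewrite -(card_in_imset f_inj) -[leqRHS]card_ord.
  have some_inj : injective (@Some 'I_m) by move=> ? ? [].
  rewrite -(card_imset _ some_inj); apply: subset_leq_card.
  apply/fintype.subsetP => _ /imsetP[j jc ->]; rewrite /f.
  by case: (chP j) => [i|]; [rewrite imset_f|rewrite jc].
have far : (n - minn m p <= #|~: close|)%N.
  rewrite cardsCs finset.setCK card_ord leq_sub2l// leq_min close_m.
  exact: card_close_rows.
apply: (@le_trans _ _ (#|~: close|%:R * d)).
  by rewrite ler_wpM2r ?ler_nat// ltW.
rewrite (bigID (mem (~: close)))/= -[leLHS]addr0 lerD//; last first.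
  by rewrite sumr_ge0// => j _; rewrite sumr_ge0.
rewrite mulr_natl -sumr_const; apply: ler_sum => j.
by rewrite !inE -leNgt.
Qed.

End ApproxIdentity.

Local Open Scope classical_set_scope.
Local Open Scope ring_scope.

(** * Lower bounds for integrals: uniform laws, translations, progressions *)

Section LowerIntegral.
Local Open Scope ereal_scope.

(* The integral of a nonnegative function is a supremum over the simple
   functions below it, so it is monotone without any measurability. *)
Lemma le_lower_integral d (T : measurableType d) (R : realType)
    (mu : set T -> \bar R) (A B : set T) (f g : T -> \bar R) :
  A `<=` B -> (forall x, A x -> 0 <= f x) -> (forall x, B x -> 0 <= g x) ->
  (forall x, A x -> f x <= g x) ->
  \int[mu]_(x in A) f x <= \int[mu]_(x in B) g x.
Proof.
move=> AB f0 g0 fg; rewrite /integral.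
have fA0 x : 0 <= (f \_ A) x.
  by rewrite patchE; case: ifPn => // /set_mem /f0.
have gB0 x : 0 <= (g \_ B) x.
  by rewrite patchE; case: ifPn => // /set_mem /g0.
have -> : (f \_ A)^\- = (g \_ B)^\-.
  by apply/funext => x; rewrite !(@ge0_funenegE _ _ setT) ?inE.
apply: leeB => //; apply: le_ereal_sup => _ /= [k kf <-]; exists k => // x.
apply: le_trans (kf x) _; rewrite !(@ge0_funeposE _ _ setT) ?inE// !patchE.
case: ifPn => [/set_mem Ax|_].
  by rewrite mem_set; [exact: fg|exact: AB].
by case: ifPn => // /set_mem /g0.
Qed.

Variable R : realType.
Local Notation mu := (@lebesgue_measure R).

(** The change of variables is done on the measurable minorant [f]; monotonicity of the lower
    integral carries the bound to [g]. *)
Lemma unif_integral_ge (lo hi : R) (f g : R -> \bar R) :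
  measurable_fun setT f -> (forall x, 0 <= f x) -> (forall x, f x <= g x) ->
  \int[mu]_(t in `[0%R, 1%R]) f (lo + (hi - lo) * t)%R <=
  \int[unif lo hi]_x g x.
Proof.
move=> mf f0 fg.
have maff : measurable_fun setT (fun t : R => lo + (hi - lo) * t)%R.
  by apply: measurable_funD => //; exact: measurable_funM.
apply: (@le_trans _ _ (\int[unif lo hi]_x f x)); last first.
  by apply: le_lower_integral => // x _; exact: le_trans (fg x).
rewrite /unif ge0_integral_pushforward//.
rewrite preimage_setT integral_uniform//=; last first.
  exact: (measurableT_comp mf maff).
by rewrite subr0 invr1 mul1e.
Qed.

Lemma unif_integral_ge0 (lo hi : R) (g : R -> \bar R) :
  (forall x, 0 <= g x) -> 0 <= \int[unif lo hi]_x g x.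
Proof.
move=> g0; apply: le_trans (@unif_integral_ge lo hi (cst 0) g _ _ g0) => //.
by rewrite integral0.
Qed.

Lemma unif_integral_ge_cst (lo hi c : R) (g : R -> \bar R) : (lo <= hi)%R ->
  (0 <= c)%R -> (forall x, 0 <= g x) ->
  (forall x, x \in `[lo, hi]%R -> c%:E <= g x) ->
  c%:E <= \int[unif lo hi]_x g x.
Proof.
move=> lohi c0 g0 cg.
(* Off [[lo, hi]] only nonnegativity of [g] is known, hence the indicator in the minorant. *)
pose f x := (c * \1_`[lo, hi] x)%:E : \bar R.
have f0 x : 0 <= f x by rewrite lee_fin mulr_ge0.
have mf : measurable_fun setT f.
  by apply/measurable_EFinP; apply: measurable_funM.
apply: le_trans (unif_integral_ge lo hi mf f0 _); last first.
  move=> x; rewrite /f indicE; case: (boolP (x \in _)) => [/set_mem xlh|_].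
    by rewrite mulr1; exact: cg.
  by rewrite mulr0 g0.
rewrite (eq_integral (cst c%:E)).
  rewrite integral_cst//= lebesgue_measure_itv/= lte_fin ltr01.
  by rewrite oppr0 adde0 mule1.
move=> t /set_mem; rewrite /= in_itv/= => /andP[t0 t1].
rewrite /f indicE mem_set ?mulr1//= in_itv/=.
have lohi' : (0 <= hi - lo)%R by rewrite subr_ge0.
apply/andP; split; first by rewrite lerDl mulr_ge0.
by rewrite -lerBrDl ler_piMr.
Qed.

Lemma lebesgue_measure_translation (a : R) (A : set R) : measurable A ->
  pushforward mu ((fun x => x + a)%R : _ -> measurableTypeR R) A = mu A.
Proof.
move=> mA; apply/esym/lebesgue_measure_unique => //= [|_ _ [[u v] _ <-]].
  exact: measurable_funD.
rewrite /pushforward.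
have -> : (fun x => x + a)%R @^-1` `]u, v] = `](u - a)%R, (v - a)%R]%classic.
  by apply/seteqP; split => x /=; rewrite !in_itv/= ltrBlDr lerBrDr.
rewrite !lebesgue_measure_itv/= !lte_fin ltrD2r.
by case: ifP => // _; rewrite -!EFinB; congr EFin; ring.
Qed.

Lemma ge0_integral_translation (a : R) (D : set R) (f : R -> \bar R) :
  measurable D -> measurable_fun D f -> (forall x, D x -> 0 <= f x) ->
  \int[mu]_(x in D) f x =
  \int[mu]_(x in [set x | D (x + a)%R]) f (x + a)%R.
Proof.
move=> mD mf f0.
have madd : measurable_fun setT
    ((fun x : R => x + a)%R : _ -> measurableTypeR R).
  exact: measurable_funD.
transitivity (\int[pushforward mu
    ((fun x : R => x + a)%R : _ -> measurableTypeR R)]_(x in D) f x).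
  apply: eq_measure_integral => A mA _.
  exact/esym/lebesgue_measure_translation.
by rewrite ge0_integral_pushforward// => x /set_mem; exact: f0.
Qed.

(** The boolean [s] covers both kinds of half-open cells: closed on the left ([true]) for the
    positions of the grid, closed on the right ([false]) for the cells between jumps. *)
Lemma trivIset_progression (s : bool) (a e : R) (D : set nat) : (0 <= e)%R ->
  trivIset D (fun j => [set` Interval (BSide s (a + j%:R * e)%R)
                                      (BSide s (a + j.+1%:R * e)%R)]).
Proof.
move=> e0; apply/trivIsetP => i j _ _.
wlog ij : i j / (i < j)%N => [hw|_].
  rewrite neq_ltn => /orP[ij|ji]; first by apply: hw => //; rewrite ltn_eqF.
  by rewrite setIC; apply: hw => //; rewrite ltn_eqF.
have lezz : (a + i.+1%:R * e <= a + j%:R * e)%R.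
  by rewrite lerD2l ler_wpM2r// ler_nat.
apply/seteqP; split => // x /=; rewrite !in_itv/=.
case: s => /= -[/andP[_ xi] /andP[jx _]].
  by have := lt_le_trans xi (le_trans lezz jx); rewrite ltxx.
by have := le_lt_trans xi (le_lt_trans lezz jx); rewrite ltxx.
Qed.

(* Cutting [a, a + n e[ into [n] cells and translating them all to the first
   one gives the integral of the sum over an arithmetic progression. *)
Lemma integral_ge_progression (a e c : R) (n : nat) (D : set R)
    (f : R -> \bar R) :
  measurable D -> measurable_fun setT f -> (forall x, 0 <= f x) ->
  (0 <= e)%R -> (0 <= c)%R -> `[a, (a + n%:R * e)%R[ `<=` D ->
  (forall x, x \in `[a, (a + e)%R[ ->
    c%:E <= \sum_(j < n) f (x + j%:R * e)%R) ->
  (c * e)%:E <= \int[mu]_(x in D) f x.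
Proof.
move=> mD mf f0 e0 c0 aD cf.
pose F (j : nat) : set R := `[(a + j%:R * e)%R, (a + j.+1%:R * e)%R[%classic.
have mF j : measurable (F j) by exact: measurable_itv.
have tF : trivIset [set` index_iota 0 n] F.
  exact: (@trivIset_progression true a e _ e0).
have mUF : measurable (\big[setU/set0]_(j <- index_iota 0 n) F j).
  exact: bigsetU_measurable.
apply: (@le_trans _ _
    (\int[mu]_(x in \big[setU/set0]_(j <- index_iota 0 n) F j) f x)).
  rewrite ge0_integral_bigsetU ?iota_uniq//; last exact: measurable_funS mf.
  rewrite big_mkord.
  have -> : (c * e)%:E = \int[mu]_(x in `[a, (a + e)%R[) c%:E.
    rewrite integral_cst//= lebesgue_measure_itv/= lte_fin ltrDl EFinM.
    have [e_gt0|] := ltP 0%R e; first by rewrite -EFinB addrAC subrr add0r.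
    by move=> e_le0; congr (_ * _%:E); apply/eqP; rewrite eq_le e0 e_le0.
  apply: (@le_trans _ _
      (\int[mu]_(x in `[a, (a + e)%R[) \sum_(j < n) f (x + j%:R * e)%R)).
    by apply: le_lower_integral => //= x _; rewrite ?lee_fin// sume_ge0.
  rewrite ge0_integral_sum//; last first.
    move=> j; apply: (@measurable_funS _ _ _ _ setT) => //.
    by apply: (measurableT_comp mf); exact: measurable_funD.
  apply: lee_sum => j _.
  rewrite [leRHS](ge0_integral_translation (j%:R * e)%R)//; last first.
    exact: measurable_funS mf.
  rewrite (_ : [set x | F j (x + j%:R * e)%R] = `[a, (a + e)%R[%classic)//.
  apply/seteqP; split => x; rewrite /F /= !in_itv/= -natr1 lerD2r;
    by rewrite mulrDl mul1r (addrC (_ * e)%R) addrA ltrD2r.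
apply: le_lower_integral => // x; rewrite -bigcup_seq => -[j /=].
rewrite mem_index_iota /= => jn; rewrite /F/= in_itv/= => /andP[jx xj].
apply: aD; rewrite /= in_itv/=; apply/andP; split.
  by apply: le_trans jx; rewrite lerDl mulr_ge0.
by apply: lt_le_trans xj _; rewrite lerD2l ler_wpM2r// ler_nat.
Qed.


End LowerIntegral.

Lemma Rintegral_sum d (T : measurableType d) (R : realType)
    (mu : {measure set T -> \bar R}) (D : set T) (I : Type) (s : seq I)
    (f : I -> T -> R) : measurable D ->
  (forall i, mu.-integrable D (EFin \o f i)) ->
  \int[mu]_(x in D) (\sum_(i <- s) f i x) =
  \sum_(i <- s) \int[mu]_(x in D) f i x.
Proof.
move=> mD fi; rewrite /Rintegral sum_fine => [|i _].
  by under eq_integral do rewrite -sumEFin; rewrite integral_sum.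
by rewrite integrable_fin_num//; exact: fi.
Qed.

(** * Approximating equidistant step functions: reduction to matrices *)

Section StepApproximation.
Variables (R : realType) (n p : nat) (h z0 d : R) (A : set R).
Variables (tau : 'I_p -> R -> R) (b : nat -> 'I_p -> R).
Local Notation mu := (@lebesgue_measure R).
Local Notation z j := (z0 + j%:R * d).

(** Here [z j] is the jump of sample [j]. Closing the cells on the right makes every step [y <= z j]
    constant on each cell, endpoints included. *)
Let cell (i : nat) : set R := `]z i, z i.+1]%classic.
(** The signed error of the network at sample [j], whose branch values are [b j]. *)
Let F (j : nat) (y : R) := h * (y <= z j)%R%:R - \sum_(k < p) b j k * tau k y.
Let T (k : 'I_p) (i : nat) := \int[mu]_(y in cell i) tau k y.

Hypotheses (h_gt0 : 0 < h) (d_gt0 : 0 < d).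
Hypothesis mA : measurable A.
Hypothesis finA : (mu A < +oo)%E.
Hypothesis cellA : forall i, (i < n)%N -> cell i `<=` A.
Hypothesis itau : forall k, mu.-integrable A (EFin \o tau k).

Let mcell i : measurable (cell i). Proof. exact: measurable_itv. Qed.

Let integrable_comb j (D : set R) : measurable D -> D `<=` A ->
  mu.-integrable D (EFin \o (fun y => \sum_(k < p) b j k * tau k y)).
Proof.
move=> mD DA; apply: (@integrableS _ _ R mu A D) => //.
rewrite (_ : _ \o _ = fun y => (\sum_(k < p) (b j k)%:E * (tau k y)%:E)%E).
  by apply: integrable_sum => // k _; apply: integrableZl => //; exact: itau.
by apply/funext => y /=; rewrite -sumEFin.
Qed.

Let measurable_step j :
  measurable_fun setT (fun y : R => h * (y <= z j)%R%:R : R).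
Proof.
apply: measurable_funM => //.
rewrite (_ : (fun y => _) = \1_(`]-oo, z j]%classic : set R)); last first.
  apply/funext => y; rewrite indicE; congr (nat_of_bool _)%:R.
  by apply/idP/idP => [yz|/set_mem]; [apply/mem_set|]; rewrite /= in_itv.
exact: measurable_indic.
Qed.

Let integrableF j : mu.-integrable A (EFin \o F j).
Proof.
pose step (y : R) := h * (y <= z j)%R%:R.
pose comb y := \sum_(k < p) b j k * tau k y.
rewrite (_ : _ \o _ = (EFin \o step) \- (EFin \o comb))%E//.
apply: integrableB => //; last exact: integrable_comb.
apply: measurable_bounded_integrable => //.
  exact: measurable_funS (measurable_step j).
exists h; split; first exact: num_real.
move=> M hM y _ /=; rewrite normrM (gtr0_norm h_gt0).
apply: le_trans (ltW hM); rewrite ger_pMr//.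
by case: (y <= z j)%R; rewrite ?normr0 ?normr1.
Qed.

Let RintegralF i j : (i < n)%N ->
  \int[mu]_(y in cell i) F j y =
    h * d * (i < j)%:R - \sum_(k < p) b j k * T k i.
Proof.
move=> lt_in.
have [cA mc] := (cellA lt_in, mcell i).
rewrite (@eq_Rintegral _ _ R mu _
    (fun y => h * (i < j)%:R - \sum_(k < p) b j k * tau k y)); last first.
  move=> y /set_mem; rewrite /cell/= in_itv/= => /andP[zy yz].
  rewrite /F; congr (h * (nat_of_bool _)%:R - _).
  have [ij|ji] := ltnP i j.
    by apply: le_trans yz _; rewrite lerD2l (ler_wpM2r (ltW d_gt0))// ler_nat.
  apply/negbTE; rewrite -ltNge; apply: le_lt_trans zy.
  by rewrite lerD2l (ler_wpM2r (ltW d_gt0))// ler_nat.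
rewrite RintegralB//; last 2 first.
- apply: measurable_bounded_integrable => //.
    by apply: le_lt_trans finA; apply: le_measure; rewrite ?inE.
  exists `|h * (i < j)%:R|; split; first exact: num_real.
  by move=> M hM y _ /=; exact: ltW.
- exact: integrable_comb.
congr (_ - _).
  rewrite Rintegral_cst//= /cell lebesgue_measure_itv/= lte_fin ltrD2l.
  rewrite ltr_pM2r// ltr_nat ltnSn -EFinB/= -natr1; ring.
have ic k : mu.-integrable (cell i) (EFin \o tau k).
  by apply: (@integrableS _ _ R mu A) => //; exact: itau.
rewrite (@Rintegral_sum _ _ R mu _ _ _ (fun k y => b j k * tau k y))//.
  by apply: eq_bigr => k _; rewrite RintegralZl//; exact: ic.
move=> k; rewrite (_ : _ \o _ = fun y => ((b j k)%:E * (tau k y)%:E)%E)//.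
by apply: integrableZl => //; exact: ic.
Qed.

Let sum_cells_le j :
  \sum_(i < n) `|\int[mu]_(y in cell i) F j y| <= \int[mu]_(y in A) `|F j y|.
Proof.
have mUF : measurable (\big[setU/set0]_(i <- index_iota 0 n) cell i).
  exact: bigsetU_measurable.
have UA : \big[setU/set0]_(i <- index_iota 0 n) cell i `<=` A.
  rewrite -bigcup_seq => y [i /=]; rewrite mem_index_iota/= => lt_in.
  exact: cellA.
have iF i : (i < n)%N -> mu.-integrable (cell i) (EFin \o F j).
  move=> lt_in; have [cA mc] := (cellA lt_in, mcell i).
  exact: (@integrableS _ _ R mu A).
apply: (@le_trans _ _ (\sum_(i < n) \int[mu]_(y in cell i) `|F j y|)).
  by apply: ler_sum => i _; apply: le_normr_Rintegral; [exact: mcell|exact: iF].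
rewrite -lee_fin -sumEFin.
under eq_bigr => i _.
  rewrite /Rintegral fineK; last first.
    apply: integrable_fin_num; first exact: mcell.
    by apply: integrable_norm; exact: iF.
  over.
rewrite /Rintegral fineK; last first.
  by apply: integrable_fin_num => //; exact: integrable_norm.
rewrite -(big_mkord xpredT (fun i => \int[mu]_(y in cell i) `|F j y|%:E)%E).
rewrite -ge0_integral_bigsetU ?iota_uniq//.
- by apply: le_lower_integral => // y _; rewrite lee_fin.
- exact: (@trivIset_progression _ false z0 d _ (ltW d_gt0)).
- apply: (measurable_funS mA UA).
  exact: measurable_int (integrable_norm (integrableF j)).
Qed.

(** The [n.+1] samples have [n] consecutive differences, whose cell integrals form the matrix
    [(h * d)%:M - c *m t]. The factor 2 appears because a sample enters at most two differences. *)
Lemma step_approximation_ge (m : nat) (ch : 'I_n -> 'I_m -> bool) :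
    (forall j : 'I_n, (exists k, b j k != b j.+1 k) -> exists i, ch j i) ->
    (forall i j j', ch j i -> ch j' i -> j = j') ->
  (((n - minn m p)%:R * (h * d))%:E <=
   2%:E * \sum_(j < n.+1) \int[mu]_(y in A) `|F j y|%:E)%E.
Proof.
move=> chE ch_inj.
pose c : 'M[R]_(n, p) := \matrix_(j, k) (b j.+1 k - b j k).
pose t : 'M[R]_(p, n) := \matrix_(k, i) T k i.
(* The indicators of [i < j.+1] and [i < j] differ exactly when [i = j], which produces the scalar
   matrix. *)
have Ec (j i : 'I_n) : ((h * d)%:M - c *m t) j i =
    \int[mu]_(y in cell i) F j.+1 y - \int[mu]_(y in cell i) F j y.
  rewrite !RintegralF// !mxE.
  rewrite [X in _ - X = _](_ : _ =
      \sum_(k < p) (b j.+1 k * T k i - b j k * T k i)).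
    rewrite sumrB ltnS leq_eqVlt eq_sym -val_eqE/=.
    by case: ltngtP => _; rewrite /= ?mulr1n ?mulr0n; ring.
  by apply: eq_bigr => k _; rewrite !mxE mulrBl.
have le_sum : (n - minn m p)%:R * (h * d) <=
    2 * \sum_(j < n.+1) \int[mu]_(y in A) `|F j y|.
  have hd_gt0 := mulr_gt0 h_gt0 d_gt0.
  apply: le_trans (@l1_dist_scalar_ge _ _ _ c t _ hd_gt0 _ _ _ ch_inj) _.
    move=> j cj0; apply: chE; apply: contrapT => /forallNP bj.
    move/negP: cj0; apply; apply/eqP/rowP => k; rewrite !mxE.
    by have /negP := bj k; rewrite negbK => /eqP ->; rewrite subrr.
  apply: (@le_trans _ _ (\sum_(j < n) (\int[mu]_(y in A) `|F j.+1 y| +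
                                       \int[mu]_(y in A) `|F j y|))).
    apply: ler_sum => j _.
    apply: le_trans (lerD (sum_cells_le _) (sum_cells_le _)).
    rewrite -big_split/=; apply: ler_sum => i _.
    by rewrite Ec ler_normB.
  rewrite big_split/= mulr_natl mulr2n lerD//.
    rewrite [leRHS]big_ord_recl/= lerDr; exact: Rintegral_ge0.
  rewrite [leRHS]big_ord_recr/= lerDl; exact: Rintegral_ge0.
apply: (@le_trans _ _ (2 * \sum_(j < n.+1) \int[mu]_(y in A) `|F j y|)%:E).
  by rewrite lee_fin.
rewrite EFinM -sumEFin; apply: lee_wpmul2l => //; apply: lee_sum => j _.
rewrite /Rintegral fineK//; apply: integrable_fin_num => //.
exact: integrable_norm (integrableF j).
Qed.

End StepApproximation.

(** * Geometry of the bump on the torus *)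

Section BumpGeometry.
Variable R : realType.
Implicit Types w xi x y a T h : R.

Let pi2_gt0 : 0 < 2 * pi :> R. Proof. by rewrite mulr_gt0// pi_gt0. Qed.

Let winding_uniq (k l : int) :
  `|(k%:~R - l%:~R) * (2 * pi)| < 2 * pi :> R -> k = l.
Proof.
rewrite normrM (gtr0_norm pi2_gt0) -{2}[2 * pi]mul1r ltr_pM2r// -intrB.
by rewrite -intr_norm ltrz1; lia.
Qed.

(* An arc of length [w] and its complement are both longer than the window
   [xi1, xi3], so the window meets at most one endpoint of the arc. *)
Lemma bump_no_alternation w x xi1 xi2 xi3 :
  xi1 < xi2 -> xi2 < xi3 -> xi3 - xi1 < w -> xi3 - xi1 < 2 * pi - w ->
  (x \in bump_set w xi1) != (x \in bump_set w xi2) ->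
  (x \in bump_set w xi2) = (x \in bump_set w xi3).
Proof.
move=> lt12 lt23 Lw Lw'.
have norm_le (u v : R) : (`|u| <= v) = (- v <= u <= v) by rewrite ler_norml.
have [/set_mem[k]|] := boolP (x \in bump_set w xi1);
  have [/set_mem[l]|] := boolP (x \in bump_set w xi2) => //;
  have [/set_mem[r]|] := boolP (x \in bump_set w xi3) => //.
(* In, out, in: the window is shorter than [2 * pi - w], so both memberships use the same copy of
   the arc, and convexity puts [x] in it for [xi2] too. *)
- move=> xr /negP x2 xk _; exfalso; apply: x2; apply/mem_set; exists k.
  have kr : k = r.
    apply: winding_uniq; move: xr xk; rewrite ltr_norml !norm_le mulrBl; lra.
  by move: xr xk; rewrite -{}kr !norm_le; lra.
(* Out, in, out: copy [l] of the arc passes entirely over [x], so the center travels more than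
   [w]. *)
- move=> /negP x3 xl /negP x1 _; exfalso.
  have xl1 : ~ `|x - xi1 - l%:~R * (2 * pi)| <= w / 2.
    by move=> x1l; apply: x1; apply/mem_set; exists l.
  have xl3 : ~ `|x - xi3 - l%:~R * (2 * pi)| <= w / 2.
    by move=> x3l; apply: x3; apply/mem_set; exists l.
  move/negP: xl1; move/negP: xl3; rewrite -!ltNge !ltr_normr.
  by move: xl; rewrite norm_le; lra.
Qed.

Lemma measurable_bump_centers w x : measurable [set xi | bump_set w xi x].
Proof.
have mk (k : int) : measurable [set xi | `|x - xi - k%:~R * (2 * pi)| <= w / 2].
  rewrite (_ : mkset _ = `[x - k%:~R * (2 * pi) - w / 2,
                           x - k%:~R * (2 * pi) + w / 2]%classic).
    exact: measurable_itv.
  by apply/seteqP; split => xi /=; rewrite in_itv/= ler_norml; lra.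
rewrite (_ : mkset _ =
    \bigcup_n [set xi | `|x - xi - (Posz n)%:~R * (2 * pi)| <= w / 2] `|`
    \bigcup_n [set xi | `|x - xi - (Negz n)%:~R * (2 * pi)| <= w / 2]).
  by apply: measurableU; apply: bigcupT_measurable => n; exact: mk.
apply/seteqP; split => xi /=.
  by case=> -[n|n] xin; [left|right]; exists n.
by case=> -[n _ xin]; [exists (Posz n)|exists (Negz n)].
Qed.

(** This provides a window of centers whose image under the shift by [theta], modulo [2 * pi], does
    not wrap around the fundamental domain. *)
Lemma exists_window (theta L : R) : 0 < L -> L <= pi ->
  exists xs ys (k : int), [/\ 0 <= xs, xs + L <= 2 * pi, 0 <= ys,
    ys + L <= 2 * pi & ys = theta + xs + k%:~R * (2 * pi)].
Proof.
move=> L0 Lpi; pose f := Num.floor (theta / (2 * pi)).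
pose r := theta - f%:~R * (2 * pi).
have r0 : 0 <= r by rewrite subr_ge0 -ler_pdivlMr// floor_le_tmp.
have r1 : r < 2 * pi.
  rewrite /r ltrBlDr -{1}[2 * pi]mul1r -mulrDl -ltr_pdivrMr// addrC -intrD1.
  exact: floorD1_gt.
have [rL|rL] := leP (r + L) (2 * pi).
  exists 0, r, (- f); split => //; first lra.
  by rewrite /r mulrNz; ring.
(* The window starts where its image wraps to 0. It fits because [r > 2 * pi - L >= pi >= L]. *)
exists (2 * pi - r), 0, (- f - 1); split; try lra.
by rewrite /r intrB mulrNz; ring.
Qed.

(** The jump is the right end of the advected arc. The left end stays before the window since
    [L < w], and the next copy of the arc stays beyond it since [L < 2 * pi - w]. *)
Lemma Gadv_ubar_window a T h w xs ys (k : int) (L xi y : R) :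
  ys = a * T + w / 2 + xs + k%:~R * (2 * pi) -> L < w -> L < 2 * pi - w ->
  xi \in `[xs, xs + L[ -> y \in `[ys, ys + L[ ->
  Gadv a T (ubar h w xi) y = h * (y <= xi + (ys - xs))%R%:R.
Proof.
move=> ysE Lw Lw'; rewrite !in_itv/= => /andP[xi0 xi1] /andP[y0 y1].
rewrite /Gadv /ubar indicE; congr (h * (nat_of_bool _)%:R).
apply/idP/idP => [/set_mem[l]|yxi].
  rewrite ler_norml => /andP[yl ly]; rewrite leNgt; apply/negP => xiy.
  have kl : k%:~R * (2 * pi) < l%:~R * (2 * pi) :> R by lra.
  have : (k + 1)%:~R * (2 * pi) <= l%:~R * (2 * pi) :> R.
    by move: kl; rewrite ltr_pM2r// ler_pM2r// ltr_int ler_int lezD1.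
  rewrite intrD mulrDl; lra.
apply/mem_set; exists k; rewrite ler_norml; lra.
Qed.

End BumpGeometry.

(** * Measurability of the error as a function of the center *)

Section Measurability.
Variable R : realType.
Local Notation mu := (@lebesgue_measure R).

(** The function is constant on each of the finitely many atoms cut out by the sets [S i], so it is
    a finite combination of their indicators. *)
Lemma measurable_fun_finite_info (m : nat) (S : 'I_m -> set R)
    (g : {ffun 'I_m -> bool} -> R) : (forall i, measurable (S i)) ->
  measurable_fun setT (fun t : R => g [ffun i => t \in S i]).
Proof.
move=> mS.
rewrite (_ : (fun t => _) = fun t : R => \sum_(s : {ffun 'I_m -> bool})
    g s * \prod_(i < m) \1_(if s i then S i else ~` S i) t); last first.
  apply/funext => t; rewrite (bigD1 [ffun i => t \in S i])//=.
  rewrite [X in _ + X]big1 => [|s sS].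
    rewrite addr0 big1 ?mulr1// => i _; rewrite ffunE indicE.
    by case: ifPn => [->|tS] //; rewrite in_setC tS.
  have [i si] : exists i, s i != (t \in S i).
    apply/existsP; apply: contraR sS; rewrite negb_exists => /forallP sS.
    by apply/eqP/ffunP => i; rewrite ffunE; apply/eqP; rewrite -[_ == _]negbK.
  rewrite (bigD1 i)//= indicE (_ : _ \in _ = false) ?mul0r ?mulr0//.
  case: (s i) si => si; apply/negbTE; first by rewrite negbT// -(negbTE si).
  by rewrite in_setC negbK; case: (_ \in _) si.
apply: measurable_sum => s; apply: measurable_funM => //.
apply: measurable_prod => i _; apply: measurable_indic.
by case: ifP => _ //; exact: measurableC.
Qed.

(** By Tonelli: the integrand is jointly measurable in the center and the point once [tau k] is
    extended by zero off [A]. *)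
Lemma measurable_step_error (p : nat) (h c : R) (A : set R)
    (b tau : 'I_p -> R -> R) :
  measurable A -> (forall k, measurable_fun setT (b k)) ->
  (forall k, measurable_fun A (tau k)) ->
  measurable_fun setT (fun t : R => \int[mu]_(y in A)
    `|h * (y <= t + c)%R%:R - \sum_(k < p) b k t * tau k y|%:E)%E.
Proof.
move=> mA mb mtau.
pose f (ty : R * R) : \bar R :=
  (`|h * (ty.2 <= ty.1 + c)%R%:R - \sum_(k < p) b k ty.1 * (tau k \_ A) ty.2|
   * \1_A ty.2)%:E.
have mf : measurable_fun setT f.
  apply/measurable_EFinP; apply: measurable_funM; last first.
    exact: (measurableT_comp (measurable_indic mA)).
  apply: measurableT_comp => //; apply: measurable_funB.
    apply: measurable_funM => //.
    rewrite (_ : (fun ty => _) = \1_[set ty : R * R | ty.2 <= ty.1 + c]).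
      apply: measurable_indic; rewrite -[X in measurable X]setTI.
      apply: measurable_fun_le => //; exact: measurable_funD.
    by apply/funext => ty; rewrite indicE; congr (nat_of_bool _)%:R;
      apply/idP/idP => [/mem_set|/set_mem].
  apply: measurable_sum => k; apply: measurable_funM.
    exact: (measurableT_comp (mb k)).
  apply: (@measurableT_comp _ _ _ _ _ _ (tau k \_ A)) => //.
  by have [+ _] := measurable_restrictT (tau k) mA; exact.
have f0 ty : (0 <= f ty)%E by rewrite lee_fin mulr_ge0.
have := measurable_fun_fubini_tonelli_F (m2 := mu) f mf f0.
apply: eq_measurable_fun => t _; rewrite /fubini_F [RHS]integral_mkcond.
apply: eq_integral => y _; rewrite /f patchE indicE/=; case: ifPn => yA.
  rewrite mulr1; congr (`|_ - _|%:E); apply: eq_bigr => k _.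
  by rewrite patchE yA.
by rewrite mulr0.
Qed.

End Measurability.

(** * Changes of one sensor along the grid of centers *)

Section SensorChange.
Variables (R : realType) (w x xi0 d : R) (n : nat).
Hypotheses (d_gt0 : 0 < d) (ndw : n%:R * d < w) (ndw' : n%:R * d < 2 * pi - w).

Let changes (j : nat) := (x \in bump_set w (xi0 + j%:R * d)) !=
                         (x \in bump_set w (xi0 + j.+1%:R * d)).

(** After a change at [j], the absence of alternation for the centers [j], [j.+1], [i] freezes the
    membership at its value for [j.+1]. *)
Lemma sensor_change_uniq (j l : 'I_n) : changes j -> changes l -> j = l.
Proof.
wlog lt_jl : j l / (j < l)%N => [hw cj cl|].
  have [jl|lj|/val_inj//] := ltngtP j l; first exact: hw.
  by apply/esym; exact: hw.
have xi_lt (i i' : nat) : (i < i')%N -> xi0 + i%:R * d < xi0 + i'%:R * d.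
  by move=> ii'; rewrite ltrD2l ltr_pM2r// ltr_nat.
have window (i i' : nat) : (i' <= n)%N ->
    xi0 + i'%:R * d - (xi0 + i%:R * d) <= n%:R * d.
  move=> i'n; have : i'%:R * d <= n%:R * d by rewrite ler_pM2r// ler_nat.
  have : 0 <= i%:R * d by rewrite mulr_ge0// ltW.
  lra.
have same (i : nat) : (j.+1 < i)%N -> (i <= n)%N -> changes j ->
    (x \in bump_set w (xi0 + j.+1%:R * d)) =
    (x \in bump_set w (xi0 + i%:R * d)).
  move=> ji lin cj; apply: bump_no_alternation cj; try exact: xi_lt.
  - exact: le_lt_trans (window _ _ lin) ndw.
  - exact: le_lt_trans (window _ _ lin) ndw'.
move=> cj; rewrite /changes -(same l.+1)//.
have [<-|lt_j1l] := eqVneq j.+1 (l : nat); first by rewrite eqxx.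
have lt_j1l' : (j.+1 < l)%N by rewrite ltn_neqAle lt_j1l.
by rewrite -(same l) ?eqxx// ltnW.
Qed.

End SensorChange.

(** * Lower bound for fixed height and width *)

Section AdvectionError.
Variable R : realType.
Local Notation mu := (@lebesgue_measure R).

(** The torus has finite measure and [|f|] is dominated by [1 + f ^+ 2]. *)
Lemma in_L2_integrable (f : R -> R) (A : set R) :
  measurable A -> A `<=` @torus R -> in_L2 f -> mu.-integrable A (EFin \o f).
Proof.
move=> mA At [mf f2].
have mtorus : measurable (@torus R) by exact: measurable_itv.
apply: (@integrableS _ _ R mu (@torus R)) => //.
have f2i : mu.-integrable (@torus R) (fun y => (f y ^+ 2)%:E).
  apply/integrableP; split.
    by apply/measurable_EFinP; exact: measurable_funX.
  under eq_integral do rewrite gee0_abs ?lee_fin ?sqr_ge0//.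
  exact: f2.
have cst1 : mu.-integrable (@torus R) (EFin \o (fun=> 1 : R)).
  apply: measurable_bounded_integrable => //.
    rewrite /= /torus lebesgue_measure_itv/=.
    by case: ifP => _; rewrite -?EFinB ltry.
  exists 1; split; first exact: num_real.
  by move=> M M1 y _ /=; rewrite normr1 ltW.
apply: le_integrable (integrableD _ cst1 f2i) => //.
  exact/measurable_EFinP.
move=> y _ /=; rewrite lee_fin.
have f20 : 0 <= 1 + f y ^+ 2 by rewrite addr_ge0// sqr_ge0.
rewrite (ger0_norm f20) ler_norml.
have := sqr_ge0 (1 - f y); have := sqr_ge0 (1 + f y).
by rewrite !expr2; lra.
Qed.

Lemma adv_error_ge (h w L a T : R) (m p : nat) (x : 'I_m -> R)
    (beta : 'rV[R]_m -> 'rV[R]_p) (tau : 'I_p -> R -> R) :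
  0 < h -> 0 < L -> L < w -> L < 2 * pi - w -> (0 < m)%N -> (0 < p)%N ->
  (forall k, in_L2 (tau k)) ->
  ((h * L ^+ 2 / (36 * pi) / (minn m p)%:R)%:E <=
   \int[unif 0 (2 * pi)]_xi
     L1_dist (Gadv a T (ubar h w xi)) (deeponet beta tau x (ubar h w xi)))%E.
Proof.
move=> h0 L0 Lw Lw' m0 p0 tau2.
have pi0 : 0 < pi :> R by exact: pi_gt0.
have pi20 : 0 < 2 * pi :> R by rewrite mulr_gt0.
have Lpi : L <= pi by lra.
have [xs [ys [k [xs0 xsL ys0 ysL ysE]]]] :=
  exists_window (a * T + w / 2) L0 Lpi.
set q := minn m p; have q0 : (0 < q)%N by rewrite leq_min m0.
(* The [(2 * q).+1] centers span only [2 * q] cells; the extra length [d] leaves room to slide the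
   grid inside the window. *)
pose d := L / (2 * q).+1%:R.
have d0 : 0 < d by rewrite divr_gt0.
have dL : (2 * q).+1%:R * d = L by rewrite /d mulrCA divff ?mulr1.
pose A : set R := `[ys, ys + L[%classic.
pose W : set R := `[xs, xs + L[%classic.
have mA : measurable A by exact: measurable_itv.
have mW : measurable W by exact: measurable_itv.
have At : A `<=` @torus R.
  by move=> y; rewrite /A /torus /= !in_itv/= => /andP[y1 y2]; apply/andP; lra.
pose b (k : 'I_p) xi := beta (\row_j ubar h w xi (x j)) 0 k.
have mb k' : measurable_fun setT (b k').
  (* The sensor vector depends on [xi] only through the bits telling which sensors lie in the
     bump. *)
  pose g (s : {ffun 'I_m -> bool}) := beta (\row_j (h * (s j)%:R)) 0 k'.
  rewrite (_ : b k' = fun xi =>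
      g [ffun j => xi \in [set xi | bump_set w xi (x j)]]).
    by apply: measurable_fun_finite_info => j; exact: measurable_bump_centers.
  apply/funext => xi; congr (beta _ 0 k'); apply/rowP => j.
  by rewrite !mxE ffunE /ubar indicE; congr (h * (nat_of_bool _)%:R).
have mtau k' : measurable_fun A (tau k').
  have [mt _] := tau2 k'.
  by apply: measurable_funS At mt; exact: measurable_itv.
pose Phi (xi : R) : \bar R := (\int[mu]_(y in A)
  `|h * (y <= xi + (ys - xs))%R%:R - \sum_(k < p) b k xi * tau k y|%:E)%E.
have Phi0 xi : (0 <= Phi xi)%E by apply: integral_ge0 => y _; rewrite lee_fin.
have mG : measurable_fun setT (Phi \_ W).
  have [+ _] := measurable_restrictT Phi mW; apply.
  apply: (@measurable_funS _ _ _ _ setT) => //.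
  exact: measurable_step_error.
have G0 xi : (0 <= (Phi \_ W) xi)%E by rewrite patchE; case: ifP.
(* Keeping only centers in [W] and points of the arc [A] lowers the error, and there the advected
   bump is a step function. *)
have GE xi : (((Phi \_ W) xi) <=
    L1_dist (Gadv a T (ubar h w xi)) (deeponet beta tau x (ubar h w xi)))%E.
  rewrite patchE; case: ifPn => [/set_mem xiW|_]; last first.
    by apply: integral_ge0 => y _; rewrite lee_fin.
  apply: le_lower_integral => // y Ay; rewrite lee_fin//.
  by rewrite (Gadv_ubar_window h ysE Lw Lw' xiW Ay).
apply: le_trans (unif_integral_ge _ _ mG G0 GE).
(* [c] bounds the error summed over one grid: [q] rows give [h * d] each, halved by the factor 2 of
   [step_approximation_ge]. [e] is the spacing in the parameter [t], where [xi = 2 * pi * t]. *)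
pose c := q%:R * (h * d) / 2.
pose e := d / (2 * pi).
have e0 : 0 <= e by rewrite divr_ge0// ltW.
have c0 : 0 <= c by rewrite divr_ge0// !mulr_ge0// ltW.
have Q1 : 1 <= q%:R :> R by rewrite ler1n.
have pi_neq0 : pi != 0 :> R by rewrite gt_eqF.
(* Here [c * e = q * h * d^2 / (4 * pi)], and [2 * q + 1 <= 3 * q] gives [d >= L / (3 * q)], whence
   the constant 36. *)
apply: (@le_trans _ _ (c * e)%:E).
  have Q_neq0 : q%:R != 0 :> R by rewrite gt_eqF// (lt_le_trans _ Q1).
  rewrite lee_fin.
  rewrite (_ : _ / _ / _ = q%:R * h / (4 * pi) * (L / (3 * q%:R)) ^+ 2);
    last by move: (@pi R) pi_neq0 => P P_neq0; field; rewrite Q_neq0.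
  rewrite (_ : c * e = q%:R * h / (4 * pi) * d ^+ 2);
    last by rewrite /c /e; move: (@pi R) pi_neq0 => P P_neq0; field.
  apply: ler_wpM2l; first by rewrite divr_ge0// mulr_ge0// ltW.
  have Ld : L / (3 * q%:R) <= d.
    rewrite /d ler_wpM2l ?(ltW L0)// lef_pV2 ?posrE ?ltr0n// ?mulr_gt0 ?ltr0n//.
    by rewrite -natrM ler_nat -[3%N]/(1 + 2)%N mulnDl mul1n -add1n leq_add2r.
  by rewrite ler_sqr ?nnegrE ?(ltW d0)// divr_ge0// ?mulr_ge0// ltW.
pose f t := (Phi \_ W) (0 + (2 * pi - 0) * t).
have mf : measurable_fun setT f.
  have maff : measurable_fun setT (fun t : R => 0 + (2 * pi - 0) * t).
    by apply: measurable_funD => //; exact: measurable_funM.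
  exact: (measurableT_comp mG maff).
apply: (@integral_ge_progression _ (xs / (2 * pi)) e c (2 * q).+1 _ f) => //.
- by move=> t; exact: G0.
- move=> t /=; rewrite !in_itv/= mulrA dL -mulrDl => /andP[t0 t1].
  rewrite (le_trans _ t0) ?divr_ge0 ?(ltW pi20)//=.
  by apply: le_trans (ltW t1) _; rewrite ler_pdivrMr// mul1r.
move=> t; rewrite in_itv/= => /andP[t0 t1].
pose xi0 := 2 * pi * t.
have xi00 : xs <= xi0 by rewrite /xi0 mulrC -ler_pdivrMr.
have xi01 : xi0 < xs + d.
  by move: t1; rewrite -mulrDl ltr_pdivlMr// mulrC.
have jd (j : nat) : (j <= 2 * q)%N -> 0 <= j%:R * d /\ j%:R * d + d <= L.
  move=> j2q; split; first by rewrite mulr_ge0// ltW.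
  by rewrite -dL -{2}[d]mul1r -mulrDl natr1 ler_pM2r// ler_nat.
have fE (j : 'I_(2 * q).+1) : f (t + j%:R * e) = Phi (xi0 + j%:R * d).
  rewrite /f (_ : 0 + _ = xi0 + j%:R * d); last first.
    by rewrite /xi0 /e; move: (@pi R) pi_neq0 => P P_neq0; field.
  rewrite patchE mem_set// /W/= in_itv/=.
  have [] := jd j _; first by rewrite -ltnS.
  by move=> ? ?; apply/andP; split; lra.
under eq_bigr do rewrite fE.
have z0E (j : nat) :
  xi0 + j%:R * d + (ys - xs) = xi0 + (ys - xs) + j%:R * d by ring.
have PhiE (j : nat) : Phi (xi0 + j%:R * d) = (\int[mu]_(y in A)
    `|h * (y <= xi0 + (ys - xs) + j%:R * d)%R%:R -
      \sum_(k < p) b k (xi0 + j%:R * d) * tau k y|%:E)%E.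
  by rewrite -z0E.
under eq_bigr do rewrite PhiE.
rewrite /c mulrC EFinM lee_pdivrMl//.
rewrite -[X in (X%:R * _)%:E](_ : (2 * q - minn m p)%N = q); last first.
  by rewrite -/q mul2n -addnn addnK.
apply: (@step_approximation_ge R (2 * q) p h (xi0 + (ys - xs)) d A tau
  (fun j k => b k (xi0 + j%:R * d)) h0 d0 mA _ _ _ m
  (fun j i => (x i \in bump_set w (xi0 + j%:R * d)) !=
              (x i \in bump_set w (xi0 + j.+1%:R * d)))).
- rewrite /A lebesgue_measure_itv/=; case: ifP => _ //.
  by rewrite -EFinB ltry.
- move=> i i2q y /=; rewrite !in_itv/= => /andP[iy yi].
  have [id0 _] := jd i (ltnW i2q); have [_ i1d] := jd i.+1 i2q.
  by apply/andP; split; [apply: le_trans (ltW iy)|apply: le_lt_trans yi _]; lra.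
- by move=> k'; apply: in_L2_integrable.
- move=> j [k' bk]; apply: contrapT => /forallNP same.
  move/negP: bk; apply; apply/eqP; congr (beta _ 0 k'); apply/rowP => i.
  rewrite !mxE /ubar !indicE; congr (h * (nat_of_bool _)%:R).
  by apply/eqP; have /negP := same i; rewrite negbK.
- move=> i j j'; have [_ ndL] := jd (2 * q)%N (leqnn _).
  by apply: sensor_change_uniq => //; lra.
Qed.

End AdvectionError.

(** * Averaging over height and width *)

Theorem theorem3p1 (R : realType) (hl hh wl wh M : R) :
  0 < hl -> hl <= hh -> 0 < wl -> wl <= wh -> wh < 2 * pi -> 0 < M ->
  exists C : R, 0 < C /\
  forall (a T : R), 0 < T ->
  forall (m p : nat), (0 < m)%N -> (0 < p)%N ->
  forall (x : 'I_m -> R) (beta : 'rV[R]_m -> 'rV[R]_p) (tau : 'I_p -> R -> R),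
    (forall j, x j \in `[0, 2 * pi[) ->
    borel_measurable beta ->
    (forall k, in_L2 (tau k)) ->
    (forall u, supp_mu hl hh wl wh u -> Linf_le M (deeponet beta tau x u)) ->
    ((C / (minn m p)%:R)%:E <=
       mu_expect hl hh wl wh
         (fun u => L1_dist (Gadv a T u) (deeponet beta tau x u)))%E.
Proof.
move=> hl0 hlh wl0 wlh wh2pi _.
have pi0 : 0 < pi :> R by exact: pi_gt0.
(* Halving makes [L] strictly smaller than [w] and [2 * pi - w] for every [w] in [[wl, wh]]. *)
pose mn := Num.min wl (2 * pi - wh); pose L := mn / 2.
have [mn0 mnwl mnwh] : [/\ 0 < mn, mn <= wl & mn <= 2 * pi - wh].
  by rewrite lt_min wl0 subr_gt0 wh2pi !ge_min !lexx orbT.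
have [L0 Lwl Lwh] : [/\ 0 < L, L < wl & L < 2 * pi - wh].
  by rewrite /L; split; lra.
(* The bound of [adv_error_ge] at the smallest height, where it is weakest. *)
exists (hl * L ^+ 2 / (36 * pi)); split.
  by rewrite divr_gt0 ?mulr_gt0 ?exprn_gt0.
move=> a T _ m p m0 p0 x beta tau _ _ tau2 _.
have mp0 : 0 < (minn m p)%:R :> R by rewrite ltr0n leq_min m0.
have dist0 (u v : R -> R) : (0 <= L1_dist u v)%E.
  by apply: integral_ge0 => y _; rewrite lee_fin.
have C0 : 0 <= hl * L ^+ 2 / (36 * pi) / (minn m p)%:R.
  by rewrite !divr_ge0 ?mulr_ge0 ?exprn_ge0// ltW.
rewrite /mu_expect; apply: unif_integral_ge_cst => // h.
  by apply: unif_integral_ge0 => w; exact: unif_integral_ge0.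
rewrite in_itv/= => /andP[hlh' _].
apply: unif_integral_ge_cst => // w; first exact: unif_integral_ge0.
rewrite in_itv/= => /andP[wlw wwh].
have h0 : 0 < h by exact: lt_le_trans hlh'.
have Lw : L < w by exact: lt_le_trans wlw.
have Lw' : L < 2 * pi - w by lra.
apply: le_trans (adv_error_ge a T x beta h0 L0 Lw Lw' m0 p0 tau2).
by rewrite lee_fin !ler_wpM2r ?invr_ge0 ?mulr_ge0 ?exprn_ge0// ltW.
Qed.
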